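(* Let $d\in\mathbb N$. For every Boolean algebra $\mathfrak A$ in the class $\mathcal I(d)$, $\text{free-dim}(K_{\mathfrak A})\le d$.
   Context: Elements $a_1,\dots,a_m$ of a Boolean algebra are independent if $\bigcap_{i\in S_1}a_i\cap\bigcap_{j\in S_2}a_j^c\ne\mathbf 0$ for every two disjoint sets $S_1,S_2\subseteq\{1,\dots,m\}$. For $d\in\mathbb N$, a Boolean algebra $\mathfrak A$ is in the class $\mathcal I(d)$ if $\mathfrak A$ is generated by a set $\Gamma\subseteq \mathfrak A$ such that no $d+1$ elements of $\Gamma$ are independent. $K_{\mathfrak A}$ denotes the Stone space of all ultrafilters on $\mathfrak A$. For a compact space $K$, $\mathrm{FCC}(K)$ denotes the family of all finite covers of $K$ by closed subsets. For finite covers $\mathcal C_1,\mathcal C_2$ of $K$ write $\mathcal C_1\prec\mathcal C_2$ ($\mathcal C_1$ refines $\mathcal C_2$) if every $C_1\in\mathcal C_1$ is contained in some $C_2\in\mathcal C_2$. A family $\mathfrak C\subseteq \mathrm{FCC}(K)$ is topologically cofinal if for every open cover $\mathcal U$ of $K$ there is $\mathcal C\in\mathfrak C$ with $\mathcal C\prec\mathcal U$ (every member of $\mathcal C$ is contained in a member of $\mathcal U$). For $d\in\mathbb N=\{0,1,2,\dots\}$, write $\text{free-dim}(K)\le d$ if there are a topologically cofinal family $\mathfrak C\subseteq\mathrm{FCC}(K)$, a constant $M>0$ and a function $\chi:\mathfrak C\to\mathbb N$ such that for every $k\ge 1$, any $\mathcal C_1,\dots,\mathcal C_k\in\mathfrak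 C$ have a joint refinement $\mathcal C\in\mathrm{FCC}(K)$ (i.e. $\mathcal C\prec\mathcal C_i$ for all $i\le k$) with $|\mathcal C|\le M\big(\chi(\mathcal C_1)+\dots+\chi(\mathcal C_k)\big)^d$ (with $0^0=1$). *)

(* Defs.v *)
From HB Require Import structures.
From mathcomp Require Import all_boot all_order all_algebra finmap.
From mathcomp Require Import all_classical all_reals topology.

Set Implicit Arguments.
Unset Strict Implicit.
Unset Printing Implicit Defensive.

Import Order.TTheory GRing.Theory Num.Theory.

Local Open Scope classical_set_scope.

(* A Boolean algebra is a [ctbDistrLatticeType]; the one-element algebra, whose
   Stone space is empty, is not excluded. *)
Section boolean_algebra.
Context {disp : Order.disp_t} {A : ctbDistrLatticeType disp}.

(* Empty meets are [\top]. An independent tuple has pairwise distinct entries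
   (take S1 = {i} and S2 = {j}), so injectivity is not required separately. *)
Definition independent (m : nat) (a : 'I_m -> A) : Prop :=
  forall S1 S2 : {set 'I_m}, [disjoint S1 & S2]%B ->
    ((\meet_(i in S1) a i) `&` (\meet_(j in S2) ~` (a j)) <> \bot)%O.

Record boolean_subalgebra (B : set A) : Prop := {
  subalgebra_bot : B \bot%O ;
  subalgebra_top : B \top%O ;
  subalgebra_meet : forall a b, B a -> B b -> B (a `&` b)%O ;
  subalgebra_join : forall a b, B a -> B b -> B (a `|` b)%O ;
  subalgebra_compl : forall a, B a -> B (~` a)%O }.

Definition generates (G : set A) : Prop :=
  smallest boolean_subalgebra G = setT.

Record proper_filter (F : set A) : Prop := {
  proper_filter_bot : ~ F \bot%O ;
  proper_filter_top : F \top%O ;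
  proper_filter_meet : forall a b, F a -> F b -> F (a `&` b)%O ;
  proper_filter_le : forall a b, (a <= b)%O -> F a -> F b }.

Definition ultrafilter (F : set A) : Prop :=
  proper_filter F /\
  forall G : set A, proper_filter G -> F `<=` G -> G = F.

End boolean_algebra.

Definition class_I {disp : Order.disp_t} (d : nat)
    (A : ctbDistrLatticeType disp) : Prop :=
  exists G : set A, generates G /\
    ~ exists a : 'I_d.+1 -> A, (forall i, G (a i)) /\ independent a.

Definition stone_space {disp : Order.disp_t} (A : ctbDistrLatticeType disp)
  : Type := {F : set A | ultrafilter F}.

Section stone_topology.
Context {disp : Order.disp_t} (A : ctbDistrLatticeType disp).

HB.instance Definition _ := gen_eqMixin (stone_space A).
HB.instance Definition _ := gen_choiceMixin (stone_space A).

Definition stone_basic (a : A) : set (stone_space A) :=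
  [set F | sval F a].

Let stone_basic_cover : \bigcup_(U in range stone_basic) U = setT.
Proof.
apply/seteqP; split=> // F _; exists (stone_basic \top%O); first by exists \top%O.
exact: proper_filter_top (svalP F).1.
Qed.

Let stone_basic_join (U V : set (stone_space A)) (F : stone_space A) :
  range stone_basic U -> range stone_basic V -> U F -> V F ->
  exists W, [/\ range stone_basic W, W F & W `<=` U `&` V].
Proof.
move=> [a _ <-] [b _ <-] Fa Fb; exists (stone_basic (a `&` b)%O); split.
- by exists (a `&` b)%O.
- exact: proper_filter_meet (svalP F).1 _ _ Fa Fb.
- move=> H Hab; split; apply: proper_filter_le (svalP H).1 _ _ _ Hab.
  + exact: leIl.
  + exact: leIr.
Qed.

(* The base is indexed by itself because the factory wants a pointed index
   type, which A is not. *)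
HB.instance Definition _ := isBaseTopological.Build (stone_space A)
  stone_basic_cover stone_basic_join.

End stone_topology.

Section free_dimension.
Context {K : topologicalType}.

(* Both for pairs of finite covers and for a finite cover and an open one. *)
Definition refines (C D : set (set K)) : Prop :=
  forall X, C X -> exists2 Y, D Y & X `<=` Y.

Definition FCC : set (set (set K)) :=
  [set C | [/\ finite_set C, (forall X, C X -> closed X)
             & \bigcup_(X in C) X = setT]].

Definition open_cover (U : set (set K)) : Prop :=
  (forall X, U X -> open X) /\ \bigcup_(X in U) X = setT.

Definition topologically_cofinal (CC : set (set (set K))) : Prop :=
  forall U, open_cover U -> exists2 C, CC C & refines C U.

End free_dimension.

Local Open Scope ring_scope.

(* "free-dim(K) <= d". The values of [chi] outside [CC] are irrelevant;
   [#|` fset_set C|] is the cardinality of the finite set C. *)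
Definition free_dim_le (R : realType) (K : topologicalType) (d : nat) : Prop :=
  exists (CC : set (set (set K))) (M : R) (chi : set (set K) -> nat),
    [/\ CC `<=` FCC, topologically_cofinal CC, 0 < M &
      forall (k : nat) (Cs : 'I_k -> set (set K)),
        (0 < k)%N -> (forall i, CC (Cs i)) ->
        exists C : set (set K),
          [/\ FCC C, (forall i, refines C (Cs i)) &
            (#|` fset_set C|)%:R <= M * ((\sum_(i < k) chi (Cs i)) ^ d)%N%:R]].

(* Main.v *)
Require Import Defs.
From mathcomp Require Import all_boot all_order all_algebra.
From mathcomp Require Import all_classical all_reals topology.
From mathcomp Require Import finmap.

(** A finite set F of generators cuts the Stone space K into cells: two points
lie in the same cell when they contain the same elements of F. These covers
[trace_cover F] are the cofinal family, with |F| + 1 as the complexity of the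
cover attached to F.

They are topologically cofinal because the generators determine everything.
Every element of the algebra is decided by the trace of a point on finitely
many generators ([determined_by_generators]), so K is separated by finite
traces; compactness of K then turns this into a refinement of any given open
cover ([trace_cover_cofinal]).

They have small joint refinements because the cover attached to the union of
F_1, ..., F_k refines each of the covers attached to the F_i. Its cells
correspond to the traces of points on that union, and a subset of F that is
shattered by the family of traces is an independent set of generators
([shattered_independent]). Hence, if no d + 1 generators are independent, the
family of traces has Vapnik-Chervonenkis dimension at most d, and the
Sauer-Shelah lemma bounds the number of traces on n generators by (n + 1)^d.
As k >= 1, the sum of the complexities |F_i| + 1 dominates n + 1, so M = 1
works, even when d = 0 or all the F_i are empty. *)

Set Implicit Arguments.
Unset Strict Implicit.
Unset Printing Implicit Defensive.

Import Order.Theory GRing.Theory Num.Theory.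

(** * The Sauer-Shelah lemma *)

Section sauer_shelah.
Variable T : finType.
Implicit Types (P : {set {set T}}) (D S X Y : {set T}).

Definition shatters P S : Prop :=
  forall Y, Y \subset S -> exists2 X, X \in P & X :&: S = Y.

(** Remove a point t of D. The members of P with t removed form the union of the
families A (members avoiding t) and B (members containing t, minus t), and the
multiplicities add up to |P| = |A u B| + |A n B|. What A u B shatters is already
shattered by P, while a set S shattered by A n B gives t + S shattered by P: so
the union obeys the hypothesis for d and the intersection obeys it for d - 1.
The induction closes since (n + 1)^e + (n + 1)^(e - 1) <= (n + 2)^e; this
inequality lets a power stand for the usual sum of binomials. Taking for d the
size of the sets that are not shattered, and not the dimension, lets the
recursion reach d = 0, where only the empty family qualifies. *)
Lemma sauer_shelah d D P :
  (forall X, X \in P -> X \subset D) ->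
  (forall S, #|S| = d -> ~ shatters P S) ->
  #|P| <= if d is e.+1 then #|D|.+1 ^ e else 0.
Proof.
have shatters0 P' X : X \in P' -> shatters P' finset.set0.
  move=> PX Y; rewrite finset.subset0 => /eqP ->.
  by exists X; rewrite ?finset.setI0.
move: {2}#|D| (erefl #|D|) => n; elim: n d D P => [|n IHn] [|e] D P cardD PD noP.
- rewrite leqn0 cards_eq0; apply/set0Pn => -[X PX].
  by apply: (noP finset.set0); [rewrite cards0 | exact: shatters0 PX].
- move/eqP: cardD; rewrite cards_eq0 => /eqP D0.
  rewrite D0 cards0 exp1n -(cards1 (finset.set0 : {set T})).
  by apply/subset_leq_card/fintype.subsetP => X /PD; rewrite D0 finset.subset0 inE.
- rewrite leqn0 cards_eq0; apply/set0Pn => -[X PX].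
  by apply: (noP finset.set0); [rewrite cards0 | exact: shatters0 PX].
have [t Dt] : exists t, t \in D by apply/card_gt0P; rewrite cardD.
pose A := [set X in P | t \notin X]%SET.
pose B := [set X :\ t | X in P :\: A]%SET.
have memB X : X \in B -> t \notin X /\ t |: X \in P.
  case/imsetP => X'; rewrite !inE => /andP[+ PX'] ->.
  by rewrite PX' /= negbK => X't; rewrite finset.setD1K// finset.setD11.
have cardP : #|P| = #|A :|: B| + #|A :&: B|.
  rewrite finset.cardsUI card_in_imset.
    rewrite -(cardsID A P); congr (#|pred_of_set _| + _).
    by apply/finset.setP => X; rewrite !inE; case: (X \in P).
  move=> X Y; rewrite !inE => /andP[+ PX] /andP[+ PY].
  rewrite PX PY /= !negbK => tX tY eqXY.
  by rewrite -(finset.setD1K tX) eqXY finset.setD1K.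
have cardD' : #|D :\ t| = n.
  by apply/eqP; rewrite -eqSS -cardD (finset.cardsD1 t D) Dt.
have subA X : X \in A -> X \subset D :\ t.
  by rewrite inE finset.subsetD1 => /andP[/PD -> ->].
have subB X : X \in B -> X \subset D :\ t.
  case/memB => tX /PD; rewrite finset.subsetD1 tX andbT.
  by move/(fintype.subset_trans (finset.subsetUr [set t] X)).
have AP X : X \in A -> X \in P by rewrite inE => /andP[].
rewrite cardP cardD.
have leU : #|A :|: B| <= n.+1 ^ e.
  rewrite -cardD'; apply: (IHn e.+1) => //.
    by move=> X; rewrite inE => /orP[/subA|/subB].
  move=> S cardS shS; apply: (noP S) => // Y YS.
  have tS : t \notin S.
    have [X + XS] := shS S (subxx S).
    rewrite -XS !inE negb_and => /orP[/andP[_ ->//]|/memB[-> //]].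
  have [X + XS] := shS Y YS; rewrite finset.in_setU => /orP[/AP PX|/memB[tX PX]].
    by exists X.
  exists (t |: X) => //; rewrite -XS; apply/finset.setP => u; rewrite !inE.
  by case: eqP => // ->; rewrite (negbTE tS) !andbF.
have leI : #|A :&: B| <= if e is f.+1 then n.+1 ^ f else 0.
  rewrite -cardD'; apply: (IHn e) => //.
    by move=> X; rewrite inE => /andP[/subA].
  move=> S cardS shS.
  have tS : t \notin S.
    have [X + XS] := shS S (subxx S).
    by rewrite -XS !inE negb_and => /andP[/andP[_ ->]].
  apply: (noP (t |: S)) => [|Y YS]; first by rewrite finset.cardsU1 tS cardS.
  have YtS : Y :\ t \subset S by rewrite finset.subDset.
  have [X] := shS _ YtS; rewrite finset.in_setI => /andP[AX /memB[tX PX]] XS.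
  case: (boolP (t \in Y)) => tY.
    by exists (t |: X) => //; rewrite -finset.setUIr XS finset.setD1K.
  exists X; first exact: AP.
  apply/finset.setP => u; move/finset.setP: XS => /(_ u); rewrite !inE.
  by case: eqP => // ->; rewrite (negbTE tX) (negbTE tY).
apply: leq_trans (leq_add leU leI) _.
case: e {IHn noP leU leI} => [|f]; first by [].
rewrite expnS addnC -mulSn expnS leq_mul2l /=.
by case: f => // f; rewrite leq_exp2r.
Qed.

End sauer_shelah.

Local Open Scope classical_set_scope.

(** * Points of the Stone space *)

Section stone_points.
Context {disp : Order.disp_t} {A : ctbDistrLatticeType disp}.
Implicit Types (x y : stone_space A) (a b : A).

Lemma stone_basicI a b : stone_basic (a `&` b)%O = stone_basic a `&` stone_basic b.
Proof.
apply/seteqP; split=> x /=.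
  move=> xab; split; apply: proper_filter_le (svalP x).1 _ _ _ xab.
    exact: leIl.
  exact: leIr.
by move=> [xa xb]; exact: proper_filter_meet (svalP x).1 _ _ xa xb.
Qed.

(** Ultrafilters are maximal proper filters, so this is where maximality turns
into primality: if an ultrafilter F omits both a and its complement, the filter
generated by F and a is still proper, hence equal to F. *)
Lemma stone_basicC a : stone_basic (~` a)%O = ~` stone_basic a.
Proof.
apply/seteqP; split=> x.
  move=> xNa xa; apply: (proper_filter_bot (svalP x).1).
  by rewrite -(meetxC a); exact: proper_filter_meet (svalP x).1 _ _ xa xNa.
move=> /= nxa; apply: contrapT => nxNa; case: x nxa nxNa => F [Ff Fmax] /= nFa nFNa.
pose H := [set c | exists2 b, F b & (b `&` a <= c)%O].
suff HF : H = F.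
  apply: nFa; rewrite -HF; exists \top%O; first exact: proper_filter_top Ff.
  by rewrite meet1x.
apply: Fmax; last by move=> b Fb; exists b => //; exact: leIl.
split.
- move=> [b Fb]; rewrite lex0 => /eqP ba0; apply: nFNa.
  by apply: (proper_filter_le Ff) Fb; rewrite -disj_leC ba0.
- by exists \top%O; [exact: proper_filter_top Ff | rewrite lex1].
- move=> c c' [b Fb bc] [b' Fb' bc']; exists (b `&` b')%O.
    exact: proper_filter_meet Ff _ _ Fb Fb'.
  by rewrite lexI (le_trans _ bc) ?(le_trans _ bc')// leI2 ?leIl ?leIr.
- by move=> c c' cc' [b Fb bc]; exists b => //; exact: le_trans cc'.
Qed.

Lemma stone_basic0 : stone_basic (\bot%O : A) = set0.
Proof. by apply/seteqP; split=> // x; exact: (proper_filter_bot (svalP x).1). Qed.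

Lemma stone_basic1 : stone_basic (\top%O : A) = setT.
Proof. by apply/seteqP; split=> // x _; exact: (proper_filter_top (svalP x).1). Qed.

Lemma stone_basicU a b : stone_basic (a `|` b)%O = stone_basic a `|` stone_basic b.
Proof.
rewrite -[(a `|` b)%O]complK complU stone_basicC stone_basicI !stone_basicC.
by rewrite setCI !setCK.
Qed.

Lemma stone_basic_bigI (I : finType) (P : pred I) (f : I -> A) x :
  (forall i, P i -> stone_basic (f i) x) ->
  stone_basic (\meet_(i | P i) f i)%O x.
Proof.
move=> xf; elim/big_ind: _ => //; first by rewrite stone_basic1.
by move=> a b xa xb; rewrite stone_basicI.
Qed.

Lemma ultrafilterP (F : set A) : proper_filter F ->
  (forall a, F a \/ F (~` a)%O) -> ultrafilter F.
Proof.
move=> Ff FaC; split=> // H Hf FH; apply/seteqP; split=> // a Ha.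
case: (FaC a) => // /FH HNa; case: (proper_filter_bot Hf).
by rewrite -(meetxC a); exact: proper_filter_meet Hf _ _ Ha HNa.
Qed.

Lemma open_stone_basic a : open (stone_basic a).
Proof.
by exists [set stone_basic a]; [move=> _ ->; exists a | rewrite bigcup_set1].
Qed.

Lemma closed_stone_basic a : closed (stone_basic a).
Proof.
by rewrite -[a]complK stone_basicC; apply/open_closedC/open_stone_basic.
Qed.

Lemma open_stoneP (U : set (stone_space A)) x : open U -> U x ->
  exists2 a, stone_basic a x & stone_basic a `<=` U.
Proof.
move=> [D sD <-] [V DV Vx]; have [a _ aV] := sD V DV.
by exists a; rewrite aV// => y Vy; exists V.
Qed.

(** This is compactness of the Stone space: the point x is a limit of Phi. As a
subset of the algebra, x consists of the a whose basic clopen set is large for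
Phi. *)
Lemma ultra_stone_point (Phi : set_system (stone_space A)) :
  UltraFilter Phi -> exists x, forall a, stone_basic a x -> Phi (stone_basic a).
Proof.
move=> UPhi; have uF : ultrafilter [set a : A | Phi (stone_basic a)].
  apply: ultrafilterP => [|a]; last first.
    by rewrite /= stone_basicC; exact: in_ultra_setVsetC.
  split=> /=.
  - by rewrite stone_basic0; exact: filter_not_empty.
  - by rewrite stone_basic1; exact: filterT.
  - by move=> a b Pa Pb; rewrite stone_basicI; exact: filterI.
  - move=> a b ab; apply: filterS => x xa.
    exact: proper_filter_le (svalP x).1 _ _ ab xa.
by exists (exist _ _ uF).
Qed.

End stone_points.

(** * Covers by traces on finitely many generators *)

Section traces.
Context {disp : Order.disp_t} {A : ctbDistrLatticeType disp}.
Implicit Types (F : {fset A}) (x y : stone_space A) (G : set A).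

Definition trace F x : {set F} := finset (fun a : F => `[< stone_basic (val a) x >]).

Definition cell F x : set (stone_space A) := [set y | trace F y = trace F x].

Definition trace_cover F : set (set (stone_space A)) := range (cell F).

Definition realized F : {set {set F}} :=
  finset (fun X : {set F} => `[< exists x, trace F x = X >]).

Lemma in_trace F x (a : F) : (a \in trace F x) = `[< stone_basic (val a) x >].
Proof. by rewrite inE. Qed.

Lemma traceP F x y : trace F x = trace F y <->
  (forall a, a \in F -> stone_basic a x <-> stone_basic a y).
Proof.
split=> [/finset.setP eqxy a Fa|eqxy].
  by have := eqxy [` Fa]%fset; rewrite !in_trace; exact: asbool_eq_equiv.
apply/finset.setP => a; rewrite !in_trace; apply: asbool_equiv_eq.
exact/eqxy/valP.
Qed.

Lemma trace_sub F F' x y : (F `<=` F')%fset ->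
  trace F' x = trace F' y -> trace F x = trace F y.
Proof.
by move=> /fsubsetP FF' /traceP eqxy; apply/traceP => a /FF'; exact: eqxy.
Qed.

Lemma trace_cover_sub F F' : (F `<=` F')%fset ->
  refines (trace_cover F') (trace_cover F).
Proof.
move=> FF' _ [x _ <-]; exists (cell F x); first by exists x.
by move=> y; exact: trace_sub.
Qed.

Lemma closed_cell F x : closed (cell F x).
Proof.
have -> : cell F x = \bigcap_(a in [set` F])
    (if `[< stone_basic a x >] then stone_basic a else ~` stone_basic a).
  apply/seteqP; split=> y.
    move/traceP => eqyx a /= /eqyx [yx xy]; case: asboolP => // nxa ya.
    exact/nxa/yx.
  move=> yF; apply/traceP => a Fa; have := yF a Fa.
  by case: asboolP.
apply: closed_bigI => a _; case: asboolP => _; first exact: closed_stone_basic.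
by rewrite -stone_basicC; exact: closed_stone_basic.
Qed.

Lemma trace_coverE F : trace_cover F =
  (fun X => [set y | trace F y = X]) @` [set` realized F].
Proof.
apply/seteqP; split=> [_ [x _ <-]|_ [X /= + <-]].
  by exists (trace F x) => //=; rewrite inE; apply/asboolP; exists x.
by rewrite inE => /asboolP[x <-]; exists x.
Qed.

Lemma FCC_trace_cover F : FCC (trace_cover F).
Proof.
split.
- by rewrite trace_coverE; apply: finite_image; exact: finite_finset.
- by move=> _ [x _ <-]; exact: closed_cell.
- by apply/seteqP; split=> // x _; exists (cell F x) => //; exists x.
Qed.

Lemma card_trace_cover F : #|` fset_set (trace_cover F)| <= #|realized F|.
Proof.
have -> : trace_cover F = (fun X => [set y | trace F y = X]) @`
    [set` [fset X in realized F]%fset].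
  rewrite trace_coverE; congr (_ @` _).
  by apply/seteqP; split=> X /=; rewrite !inE.
rewrite fset_set_image ?set_fsetK; last exact: finite_fset.
rewrite (leq_trans (leq_imfset_card _ _ _))//=.
by rewrite (leq_trans (leq_imfset_card _ _ _))//= -cardE.
Qed.

(** A realized trace that meets S exactly in the elements indexed by S1 comes
from a point of K which contains these and the complements of the others. Such
a point contains the meet required by independence, which is then nonzero. *)
Lemma shattered_independent F (S : {set F}) : shatters (realized F) S ->
  independent (fun i : 'I_#|S| => val (enum_val i)).
Proof.
move=> shS S1 S2 dis.
(* The statement is about indices; S1 is moved into S along enum_val. *)
have [X + XS] : exists2 X, X \in realized F & finset.setI X S =
    finset.finset (fun a => a \in [seq enum_val i | i in S1]).
  apply: shS; apply/fintype.subsetP => a; rewrite inE => /fintype.imageP[i _ ->].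
  exact: enum_valP.
rewrite inE => /asboolP[x xX]; rewrite -{X}xX in XS.
have memx i : `[< stone_basic (val (enum_val i)) x >] = (i \in S1).
  move/finset.setP: XS => /(_ (enum_val i)).
  rewrite finset.in_setI in_trace enum_valP andbT inE fintype.mem_image//.
  exact: enum_val_inj.
suff : stone_basic ((\meet_(i in S1) val (enum_val i)) `&`
    (\meet_(j in S2) ~` (val (enum_val j))))%O x.
  by move=> + eq0; rewrite eq0 stone_basic0.
rewrite stone_basicI; split; apply: stone_basic_bigI => i Si.
  by apply/asboolP; rewrite memx.
rewrite stone_basicC; apply/asboolPn; rewrite memx.
by rewrite (disjointFl dis Si).
Qed.

(** The elements decided by a finite trace form a subalgebra containing G. *)
Lemma determined_by_generators G a : generates G ->
  exists2 F, [set` F] `<=` G &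
    forall x y, trace F x = trace F y -> stone_basic a x -> stone_basic a y.
Proof.
move=> genG; pose B := [set a | exists2 F, [set` F] `<=` G &
  forall x y, trace F x = trace F y -> stone_basic a x -> stone_basic a y].
suff : smallest boolean_subalgebra G `<=` B by rewrite genG; exact.
have sub0 : [set` (fset0 : {fset A})] `<=` G by move=> ?; rewrite /= inE.
have subU F F' : [set` F] `<=` G -> [set` F'] `<=` G ->
    [set` (F `|` F')%fset] `<=` G.
  by move=> FG F'G b /=; rewrite inE => /orP[/FG|/F'G].
apply: smallest_sub => [|b Gb]; last first.
  exists [fset b]%fset => [c /=|x y /traceP/(_ b)]; first by rewrite inE => /eqP->.
  by rewrite inE => /(_ (eqxx _))[].
split.
- by exists fset0 => // x y _; rewrite stone_basic0.
- by exists fset0 => // x y _; rewrite stone_basic1.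
- move=> b c [F FG Fb] [F' F'G F'c]; exists (F `|` F')%fset; first exact: subU.
  move=> x y eqxy; rewrite stone_basicI => -[xb xc]; split.
    exact: Fb (trace_sub (fsubsetUl _ _) eqxy) xb.
  exact: F'c (trace_sub (fsubsetUr _ _) eqxy) xc.
- move=> b c [F FG Fb] [F' F'G F'c]; exists (F `|` F')%fset; first exact: subU.
  move=> x y eqxy; rewrite stone_basicU => -[xb|xc]; [left|right].
    exact: Fb (trace_sub (fsubsetUl _ _) eqxy) xb.
  exact: F'c (trace_sub (fsubsetUr _ _) eqxy) xc.
- move=> b [F FG Fb]; exists F => // x y eqxy; rewrite stone_basicC => nxb yb.
  exact/nxb/(Fb y).
Qed.

(** A point is bad for F when its cell is contained in no member of U. Bad sets
decrease as F grows, so if none is empty they lie in a common ultrafilter Phi,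
which has a limit x. But x has a basic neighborhood inside a member of U, and
that neighborhood is decided by some finite F. As Phi contains it together with
the set of bad points for F, some point of it is bad for F, although its cell
lies inside the neighborhood. *)
Lemma trace_cover_cofinal G : generates G ->
  topologically_cofinal [set trace_cover F | F in [set F | [set` F] `<=` G]].
Proof.
move=> genG U [Uopen Ucover]; apply: contrapT => noF.
pose bad F := [set x | forall V, U V -> ~ cell F x `<=` V].
pose Phi0 := filter_from [set F : {fset A} | [set` F] `<=` G] bad.
have bad_neq0 F : [set` F] `<=` G -> bad F !=set0.
  move=> FG; apply: contrapT => nbad; apply: noF.
  exists (trace_cover F); first by exists F.
  move=> _ [x _ <-]; apply: contrapT => nx; apply: nbad; exists x => V UV xV.
  by apply: nx; exists V.
have PPhi0 : ProperFilter Phi0.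
  apply: filter_from_proper => //; apply: filter_from_filter.
    by exists fset0 => a; rewrite /= inE.
  move=> F F' FG F'G; exists (F `|` F')%fset.
    by move=> b /=; rewrite inE => /orP[/FG|/F'G].
  move=> x xbad; split=> V UV xV; apply: (xbad V UV) => y /trace_sub xy.
    exact/xV/xy/fsubsetUl.
  exact/xV/xy/fsubsetUr.
have [Phi [UPhi sPhi]] := ultraFilterLemma PPhi0.
have [x xPhi] := ultra_stone_point UPhi.
have [V UV Vx] : (\bigcup_(V in U) V) x by rewrite Ucover.
have [a xa aV] := open_stoneP (Uopen V UV) Vx.
have [F FG Fa] := determined_by_generators a genG.
have /filter_ex[y [ya ybad]] : Phi (stone_basic a `&` bad F).
  by apply: filterI; [exact: xPhi | apply: sPhi; exists F].
apply: (ybad V UV) => z zy; apply: aV; exact: Fa (esym zy) ya.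
Qed.

Lemma card_realized d G F : [set` F] `<=` G ->
  ~ (exists a : 'I_d.+1 -> A, (forall i, G (a i)) /\ independent a) ->
  #|realized F| <= #|` F|.+1 ^ d.
Proof.
move=> FG noind; rewrite cardfE -cardsT.
apply: (sauer_shelah (d := d.+1)) => [X _|S cardS shS].
  exact: finset.subsetT.
apply: noind; rewrite -cardS.
exists (fun i => val (enum_val i)); split; last exact: shattered_independent.
by move=> i; apply: FG; exact: valP.
Qed.

End traces.

Theorem corollary4p5 (R : realType) (d : nat) (disp : Order.disp_t)
    (A : ctbDistrLatticeType disp) (hA : class_I d A) :
  free_dim_le R (stone_space A) d.
Proof.
case: hA => G [genG noind].
pose CC := [set @trace_cover _ A F | F in [set F | [set` F] `<=` G]].
(* The complexity must be a function of the cover alone, hence the choice of a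
   finite set of generators producing it. *)
have /boolp.choice[F FP] C : exists F : {fset A},
    CC C -> [set` F] `<=` G /\ trace_cover F = C.
  have [[F FG FC]|nC] := pselect (CC C); first by exists F.
  by exists fset0.
exists CC, 1%R, (fun C => #|` F C|.+1); split.
- by move=> _ [F' _ <-]; exact: FCC_trace_cover.
- exact: trace_cover_cofinal.
- exact: ltr01.
move=> k Cs k0 CsP.
pose E := \big[fsetU/fset0]_(i < k) F (Cs i).
exists (trace_cover E); split.
- exact: FCC_trace_cover.
- move=> i; rewrite -[Cs i](FP _ (CsP i)).2.
  by apply: trace_cover_sub; exact: bigfcup_sup.
rewrite mul1r ler_nat; apply: leq_trans (card_trace_cover E) _.
have EG : [set` E] `<=` G.
  move=> a /bigfcupP[i _]; exact: (FP _ (CsP i)).1.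
apply: leq_trans (card_realized EG noind) _.
(* The single + 1 on the left is absorbed by any one of the k > 0 terms. *)
have leE : #|` E|.+1 <= \sum_(i < k) #|` F (Cs i)|.+1.
  have cardE : #|` E| <= \sum_(i < k) #|` F (Cs i)|.
    rewrite /E; elim/big_rec2: _ => [|i n X _ IH]; first by rewrite cardfs0.
    by rewrite (leq_trans (leq_card_fsetU _ _))// leq_add2l.
  under eq_bigr do rewrite -addn1.
  by rewrite big_split /= sum1_card card_ord -addn1 leq_add.
(* For d = 0 both powers are 1; otherwise the power is monotone. *)
by case: d {noind} => // d; rewrite leq_exp2r.
Qed.
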